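(* Let $c\in[0,1)$. Assume that for every $\pi\in\Pi$ the essential infimum of $\mathcal R$ under $d^\pi$ equals $R_{\min}:=\inf_{s\in\mathcal S}\mathcal R(s)$. Then for every $\pi\in\Pi$ $$\min_{W\in\mathcal W^\pi_c}\mathbb E_{d^\pi}[W(S)\mathcal R(S)] = cR_{\min}+(1-c)\max_{\beta\in\mathbb R}\Big\{\beta-\tfrac{1}{1-c}\mathbb E_{d^\pi}\big[(\beta-\mathcal R(S))_+\big]\Big\},$$ and $$\operatorname*{argmax}_{\pi\in\Pi}\ \min_{W\in\mathcal W^\pi_c}\mathbb E_{d^\pi}[W(S)\mathcal R(S)]=\operatorname*{argmax}_{\pi\in\Pi}\ \max_{\beta\in\mathbb R}\Big\{\beta-\tfrac{1}{1-c}\mathbb E_{d^\pi}\big[(\beta-\mathcal R(S))_+\big]\Big\}.$$ Here $\min$ over $\mathcal W^\pi_c$ is understood as the infimum.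
   Context: $\mathcal S$ is the state space of a Markov decision process with finite action set $\mathcal A$ and transition kernel $P(\cdot\mid s,a)$, with Borel $\sigma$-algebra $\mathcal B(\mathcal S)$. $\Pi$ is a class of stationary Markov policies $\pi(a\mid s)$; for each $\pi\in\Pi$ the induced Markov chain on $\mathcal S$ is positive Harris recurrent and aperiodic, with stationary distribution $d^\pi$ (a probability measure on $\mathcal S$, assumed to have a Lebesgue density). The reward function $\mathcal R:\mathcal S\to\mathbb R$ is measurable and $|\mathcal R|\le R_{\max}<\infty$. $\mathbb E_{d^\pi}$ is expectation for $S\sim d^\pi$, and $x_+=\max(x,0)$. Let $\phi(x)=\frac12|x-1|$ for $x\ge0$ and $\phi(x)=+\infty$ for $x<0$. The set of likelihood ratios is $$\mathcal W^\pi_c=\{W\in L^1(\mathcal S,\mathcal B(\mathcal S),d^\pi):\ \mathbb E_{d^\pi}[\phi(W(S))]\le c,\ W(s)\ge0\ \forall s\in\mathcal S,\ \mathbb E_{d^\pi}[W(S)]=1\}.$$ (It corresponds, via $W=du/dd^\pi$, to the probability measures $u\ll d^\pi$ with total variation distance at most $c$ from $d^\pi$.) *)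

(* Defs.v *)
From HB Require Import structures.
From mathcomp Require Import all_boot all_order all_algebra.
From mathcomp Require Import all_classical all_reals all_analysis. 

Set Implicit Arguments.
Unset Strict Implicit.
Unset Printing Implicit Defensive.
Import Order.TTheory GRing.Theory Num.Theory.
Import numFieldNormedType.Exports.
Local Open Scope classical_set_scope.
Local Open Scope ring_scope.
Local Open Scope ereal_scope.

Lemma product_sigma_finite d1 d2 (T1 : measurableType d1)
    (T2 : measurableType d2) (R : realType)
    (m1 : {sigma_finite_measure set T1 -> \bar R})
    (m2 : {sigma_finite_measure set T2 -> \bar R}) :
  sigma_finite setT (m1 \x m2).
Proof.
have /sigma_finiteP[F [TF ndF Foo]] := sigma_finiteT m1.
have /sigma_finiteP[G [TG ndG Goo]] := sigma_finiteT m2.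
exists (fun n => F n `*` G n).
  rewrite -setXTT TF TG predeqE => -[x y]; split.
    move=> [/= [n _ Fnx] [k _ Gky]]; exists (maxn n k) => //; split.
    - by move: x Fnx; exact/subsetPset/ndF/leq_maxl.
    - by move: y Gky; exact/subsetPset/ndG/leq_maxr.
  by move=> [n _ []/= ? ?]; split; exists n.
move=> k; have [? ?] := Foo k; have [? ?] := Goo k.
split; first exact: measurableX.
by rewrite product_measure1E// lte_mul_pinfty// ge0_fin_numE.
Qed.

Section lebesgue_tuple.
Context {R : realType}.

Definition tuple_cons n (p : R * n.-tuple R) : n.+1.-tuple R :=
  [tuple of p.1 :: p.2].

Definition tuple_uncons n (t : n.+1.-tuple R) : R * n.-tuple R :=
  (thead t, [tuple of behead t]).

Lemma tuple_consK n : cancel (@tuple_cons n) (@tuple_uncons n).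
Proof. by move=> [x t]; congr pair; apply/val_inj. Qed.

Lemma tuple_unconsK n : cancel (@tuple_uncons n) (@tuple_cons n).
Proof. by move=> t; rewrite [RHS]tuple_eta; apply/val_inj. Qed.

Lemma measurable_tuple_cons n : measurable_fun setT (@tuple_cons n).
Proof. exact: measurable_cons. Qed.

Lemma measurable_tuple_uncons n : measurable_fun setT (@tuple_uncons n).
Proof.
apply/measurable_fun_pair; last exact: measurable_behead.
exact: measurable_tnth.
Qed.

Section step.
Variables (n : nat) (m : {sigma_finite_measure set (n.-tuple R) -> \bar R}).

Definition lebesgue_step :=
  pushforward (@lebesgue_measure R \x m) (@tuple_cons n).

Let step0 : lebesgue_step set0 = 0.
Proof. by rewrite /lebesgue_step /pushforward preimage_set0 measure0. Qed.

Let step_ge0 B : 0 <= lebesgue_step B.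
Proof. by rewrite /lebesgue_step /pushforward. Qed.

Let step_sigma_additive : semi_sigma_additive lebesgue_step.
Proof.
move=> F mF tF mUF; rewrite /lebesgue_step /pushforward preimage_bigcup.
apply: measure_semi_sigma_additive.
- move=> k; rewrite -[X in measurable X]setTI.
  exact: measurable_tuple_cons.
- apply/trivIsetP => /= i j _ _ ij; rewrite -preimage_setI.
  by move/trivIsetP : tF => /(_ _ _ _ _ ij) ->//; rewrite preimage_set0.
- rewrite -preimage_bigcup -[X in measurable X]setTI.
  exact: measurable_tuple_cons.
Qed.

HB.instance Definition _ := isMeasure.Build _ _ _ lebesgue_step
  step0 step_ge0 step_sigma_additive.

Let step_sigma_finite : sigma_finite setT lebesgue_step.
Proof.
have [F FT mF] := product_sigma_finite (@lebesgue_measure R) m.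
exists (fun k => @tuple_uncons n @^-1` F k).
  by rewrite -preimage_bigcup -FT preimage_setT.
move=> k; have [mFk Fk] := mF k; split.
  by rewrite -[X in measurable X]setTI; exact: measurable_tuple_uncons.
rewrite /lebesgue_step /pushforward -comp_preimage.
rewrite (_ : _ \o _ = id) ?preimage_id//.
by apply/funext => x /=; rewrite tuple_consK.
Qed.

HB.instance Definition _ := Measure_isSigmaFinite.Build _ _ _ lebesgue_step
  step_sigma_finite.

End step.

(* Lebesgue measure on R^n: the unit mass on the one-point space R^0, then the
   product of the one-dimensional Lebesgue measure with Lebesgue measure on R^n,
   transported along R * R^n ~ R^(n+1). *)
Fixpoint lebesgue_tuple n : {sigma_finite_measure set (n.-tuple R) -> \bar R} :=
  if n is k.+1 return {sigma_finite_measure set (n.-tuple R) -> \bar R}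
  then lebesgue_step (lebesgue_tuple k) else dirac [tuple].

End lebesgue_tuple.

(* A measurable space that is (a copy, through [emb], of) a Borel subset of
   R^n with its Borel sigma-algebra. *)
Definition borel_embedding (R : realType) (n : nat) d (S : measurableType d)
    (emb : S -> n.-tuple R) : Prop :=
  [/\ injective emb, measurable (range emb) &
      measurable = preimage_set_system setT emb measurable].

Definition has_lebesgue_density (R : realType) (n : nat) d
    (S : measurableType d) (emb : S -> n.-tuple R) (mu : probability S R) :=
  exists f : n.-tuple R -> R, [/\ measurable_fun setT f,
    forall x, (0 <= f x)%R &
    forall B, measurable B ->
      pushforward mu emb B = \int[lebesgue_tuple n]_(x in B) (f x)%:E].

Section markov_chain.
Context d (S : measurableType d) (R : realType).
Implicit Types (K : S -> {measure set S -> \bar R}) (B : set S).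

(* [first_hit K B n x] is the probability that the chain started at x has its
   first visit to B, over times >= 1, at time n.+1. *)
Fixpoint first_hit K B (n : nat) (x : S) : \bar R :=
  if n is k.+1 then \int[K x]_(y in ~` B) first_hit K B k y else K x B.

Definition hitting_probability K B (x : S) : \bar R :=
  \sum_(0 <= n <oo) first_hit K B n x.

Definition harris_recurrent K : Prop :=
  exists phi : {sigma_finite_measure set S -> \bar R},
    0 < phi setT /\
    forall B, measurable B -> 0 < phi B ->
      forall x, hitting_probability K B x = 1.

Definition stationary K (mu : probability S R) : Prop :=
  forall B, measurable B -> \int[mu]_x K x B = mu B.

Definition positive_harris K : Prop :=
  harris_recurrent K /\ exists mu, stationary K mu.

(* Absence of a cyclic decomposition of period p >= 2 that carries stationary
   mass. *)
Definition aperiodic K (mu : probability S R) : Prop :=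
  forall (p : nat) (D : nat -> set S), (1 < p)%N ->
    (forall i, (i < p)%N -> measurable (D i)) ->
    (forall i j, (i < p)%N -> (j < p)%N -> i <> j -> D i `&` D j = set0) ->
    (forall i x, (i < p)%N -> D i x -> K x (D (i.+1 %% p)%N) = 1) ->
    mu (D 0%N) = 0.

End markov_chain.

(* The chain with transitions B |-> \sum_a pi(a | s) P(B | s, a), as the
   composition of the policy with the transition kernel. *)
Definition induced_chain d d' (S : measurableType d) (A : measurableType d')
    (R : realType) (P : R.-pker (S * A) ~> S) (pi : R.-pker S ~> A) :
    S -> {measure set S -> \bar R} :=
  mkcomp pi P.

Section robust.
Context d (S : measurableType d) (R : realType).
Implicit Types (mu : probability S R) (c beta : R) (W rew : S -> R).

Definition phi_tv (x : R) : \bar R :=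
  if (0 <= x)%R then (2^-1 * `|x - 1|)%:E else +oo.

Definition likelihood_ratios mu c : set (S -> R) :=
  [set W | [/\ mu.-integrable setT (EFin \o W),
    \int[mu]_s phi_tv (W s) <= c%:E,
    forall s, (0 <= W s)%R &
    'E_mu[W] = 1] ].

Definition worst_case_reward mu c rew : \bar R :=
  ereal_inf [set 'E_mu[(W \* rew)%R] | W in likelihood_ratios mu c].

Definition cvar_objective mu c rew beta : \bar R :=
  beta%:E -
  ((1 - c)^-1)%:E * 'E_mu[(fun s => Num.max (beta - rew s) 0)%R].

Definition cvar mu c rew : \bar R := ereal_sup (range (cvar_objective mu c rew)).

End robust.

Definition argmax (T : Type) d (V : porderType d) (D : set T) (f : T -> V) :
    set T :=
  [set x | D x /\ forall y, D y -> (f y <= f x)%O].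

(* Main.v *)
(* Write m for the essential infimum of R. If W is a likelihood ratio, then
   min(W, 1) has mass at least 1 - c, and pricing the excess mass W - min(W, 1)
   at m leaves E[W R] >= c m + (1 - c) (b - E[(b - R)_+] / (1 - c)) for all b.
   Conversely, keep the lowest 1 - c of the mass of R, i.e. V = 1 below the
   (1 - c)-quantile q, a fraction on {R = q} and 0 above it, and spread the
   remaining mass c over {R < m + e}, which has positive probability: this
   attains the bound at b = q up to c e. Hence b = q maximizes the objective,
   and the worst-case reward is an increasing affine function of the CVaR. *)
Require Import Defs.
From mathcomp Require Import all_boot all_order all_algebra.
From mathcomp Require Import all_classical all_reals all_analysis.
From mathcomp Require Import ess_sup_inf.
From mathcomp Require Import measurable_realfun lra.
Set Implicit Arguments.
Unset Strict Implicit.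
Unset Printing Implicit Defensive.
Import Order.TTheory GRing.Theory Num.Theory.
Import numFieldNormedType.Exports.
Local Open Scope classical_set_scope.
Local Open Scope ring_scope.
Local Open Scope ereal_scope.

(** * Quantiles and the essential infimum of a bounded random variable *)

Section bounded_random_variable.
Context d (S : measurableType d) (R : realType) (mu : probability S R).
Implicit Types (X W f : S -> R) (a b M p q t x : R).

Lemma bounded_integrable f M : measurable_fun setT f ->
  (forall s, (`|f s| <= M)%R) -> mu.-integrable setT (EFin \o f).
Proof.
move=> mf fM; apply: (@le_integrable _ _ _ mu _ _ _ (EFin \o cst M)) => //.
- exact/measurable_EFinP.
- by move=> s _ /=; rewrite lee_fin (le_trans (fM s))// ler_norm.
- exact: finite_measure_integrable_cst.
Qed.

Lemma expectation_Rintegral f : mu.-integrable setT (EFin \o f) ->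
  'E_mu[f] = (\int[mu]_s f s)%:E.
Proof.
by move=> intf; rewrite unlock /Rintegral fineK// integrable_fin_num.
Qed.

Lemma Rintegral_indic B : measurable B ->
  (\int[mu]_s \1_B s)%R = fine (mu B).
Proof. by move=> mB; rewrite /Rintegral integral_indic// setIT. Qed.

Lemma measurable_ltr_set X x : measurable_fun setT X ->
  measurable [set s | (X s < x)%R].
Proof.
move=> mX; rewrite (_ : mkset _ = X @^-1` `]-oo, x[).
  by rewrite -[_ @^-1` _]setTI; exact: mX.
by apply/seteqP; split => s /=; rewrite in_itv.
Qed.

Lemma measurable_ler_set X x : measurable_fun setT X ->
  measurable [set s | (X s <= x)%R].
Proof.
move=> mX; rewrite (_ : mkset _ = X @^-1` `]-oo, x]).
  by rewrite -[_ @^-1` _]setTI; exact: mX.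
by apply/seteqP; split => s /=; rewrite in_itv.
Qed.

Lemma measurable_eqr_set X x : measurable_fun setT X ->
  measurable [set s | X s = x].
Proof.
move=> mX; rewrite (_ : mkset _ = X @^-1` [set x])//.
by rewrite -[_ @^-1` _]setTI; exact: mX.
Qed.

(* The fraction [t] is needed when the law of [X] has an atom at its quantile
   [q] of order [p]. *)
Lemma quantile_split X M p : measurable_fun setT X ->
  (forall s, (`|X s| <= M)%R) -> (0 < p <= 1)%R ->
  exists q t, (0 <= t <= 1)%R /\
    (fine (mu [set s | (X s < q)%R]) + t * fine (mu [set s | X s = q]))%R = p.
Proof.
move=> mX XM /andP[p0 p1].
pose F x := mu [set s | (X s <= x)%R].
have mF x : measurable [set s | (X s <= x)%R] by exact: measurable_ler_set.
have Fnd x y : (x <= y)%R -> F x <= F y.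
  move=> xy; apply: le_measure; rewrite ?inE//.
  by move=> s /= /le_trans; apply.
pose Q := [set x | p%:E <= F x].
have QM : Q M.
  rewrite /Q/= /F (_ : mkset _ = setT) ?probability_setT ?lee_fin//.
  by apply/seteqP; split=> // s _ /=; rewrite (le_trans _ (XM s))// ler_norm.
have lbQ : has_lbound Q.
  exists (- M)%R => x; rewrite /Q/= => pFx; rewrite leNgt; apply/negP => xM.
  move: pFx; rewrite /F (_ : mkset _ = set0) ?measure0 ?lee_fin ?leNgt ?p0//.
  apply/seteqP; split => // s /=; apply/negP; rewrite -ltNge.
  by apply: (lt_le_trans xM); have := XM s; rewrite ler_norml => /andP[].
(* The lower [p]-quantile. It is a real number because [Q] contains [M] and, as [p] is positive, has
   no point below [- M]. *)
pose q := inf Q.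
have Fbelow y : (y < q)%R -> F y <= p%:E.
  by move=> yq; rewrite leNgt; apply/negP => /ltW /(ge_inf lbQ); rewrite leNgt yq.
have Fabove y : (q < y)%R -> p%:E <= F y.
  move=> qy; have [|x Qx xy] := @inf_lt _ Q y _ qy; first by exists M.
  exact: (le_trans Qx (Fnd _ _ (ltW xy))).
have invS0 k : (0 < k.+1%:R^-1 :> R)%R by rewrite invr_gt0.
have invSS k l : (k <= l)%N -> (l.+1%:R^-1 <= k.+1%:R^-1 :> R)%R.
  by move=> kl; rewrite lef_pV2 ?posrE// ler_nat.
(* Continuity from below, along levels strictly below [q], where [F] is at most [p]. *)
have Flt : mu [set s | (X s < q)%R] <= p%:E.
  pose G k := [set s | (X s <= q - k.+1%:R^-1)%R].
  have GE : [set s | (X s < q)%R] = \bigcup_k G k.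
    apply/seteqP; split => [s /= Xq|s [k _]]; last first.
      by rewrite /G/= => /le_lt_trans; apply; rewrite ltrBlDr ltrDl.
    have [k Xk] := ltr_add_invr Xq; exists k => //.
    by rewrite /G/= lerBrDr ltW.
  have cG : mu \o G @ \oo --> mu (\bigcup_k G k).
    have mG k : measurable (G k) by exact: mF.
    apply: nondecreasing_cvg_mu => //; first exact: bigcupT_measurable.
    move=> k l kl; apply/subsetPset => s; rewrite /G/= => /le_trans; apply.
    by rewrite lerB// invSS.
  rewrite GE -(cvg_lim _ cG)//; apply: lime_le; first exact: cvgP cG.
  by apply: nearW => k; apply: Fbelow; rewrite ltrBlDr ltrDl.
(* Continuity from above, along levels strictly above [q], where [F] is at least [p]. *)
have Fle : p%:E <= F q.
  pose G k := [set s | (X s <= q + k.+1%:R^-1)%R].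
  have GE : [set s | (X s <= q)%R] = \bigcap_k G k.
    apply/seteqP; split => [s /= Xq k _|s GXs /=].
      by rewrite /G/= (le_trans Xq)// lerDl ltW.
    rewrite leNgt; apply/negP => /ltr_add_invr[k Xk].
    by have := GXs k I; rewrite /G/= leNgt Xk.
  have cG : mu \o G @ \oo --> mu (\bigcap_k G k).
    have mG k : measurable (G k) by exact: mF.
    apply: nonincreasing_cvg_mu => //.
    - by rewrite (le_lt_trans (probability_le1 _ _))// ltry.
    - exact: bigcapT_measurable.
    - move=> k l kl; apply/subsetPset => s; rewrite /G/= => /le_trans; apply.
      by rewrite lerD2l invSS.
  rewrite /F GE -(cvg_lim _ cG)//; apply: lime_ge; first exact: cvgP cG.
  by apply: nearW => k; apply: Fabove; rewrite ltrDl.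
set u := fine (mu [set s | (X s < q)%R]).
set v := fine (mu [set s | X s = q]).
have mlt : measurable [set s | (X s < q)%R] by exact: measurable_ltr_set.
have meq : measurable [set s | X s = q] by exact: measurable_eqr_set.
have uE : mu [set s | (X s < q)%R] = u%:E by rewrite fineK// fin_num_measure.
have vE : mu [set s | X s = q] = v%:E by rewrite fineK// fin_num_measure.
have FqE : F q = (u + v)%:E.
  rewrite EFinD -uE -vE -measureU//.
  - rewrite /F; congr (mu _); apply/seteqP; split => s /=; rewrite le_eqVlt.
      by move=> /predU1P[]; [right|left].
    by move=> [->|->]; rewrite ?orbT ?eqxx.
  - by apply/seteqP; split => // s /= [/[swap]->]; rewrite ltxx.
move: Flt Fle; rewrite FqE uE !lee_fin => up puv.
have v0 : (0 <= v)%R by rewrite fine_ge0.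
(* Now [u <= p <= u + v]. Without an atom at [q] this forces [u = p]; otherwise the fraction
   [(p - u) / v] of the atom supplies the missing mass. *)
exists q; have [vz|vn0] := eqVneq v 0%R.
  by exists 0%R; rewrite lexx ler01 -/u -/v vz; split => //; lra.
have vp : (0 < v)%R by rewrite lt_neqAle eq_sym vn0.
exists ((p - u) / v)%R; split; last by rewrite -/u -/v divfK//; lra.
rewrite divr_ge0//=; last lra.
by rewrite ler_pdivrMr// mul1r; lra.
Qed.

(** Otherwise [b] would be an almost everywhere lower bound of [X] exceeding its essential
    infimum. *)
Lemma ess_inf_lt_gt0 X a b : measurable_fun setT X ->
  ess_inf mu (EFin \o X) = a%:E -> (a < b)%R ->
  0 < mu [set s | (X s < b)%R].
Proof.
move=> mX Xa ab; rewrite lt0e measure_ge0 andbT; apply/eqP => mu0.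
have : b%:E <= ess_inf mu (EFin \o X).
  apply/ess_infP; exists [set s | (X s < b)%R]; split => //.
    exact: measurable_ltr_set.
  by move=> s /= /negP; rewrite lee_fin -ltNge.
by rewrite Xa lee_fin leNgt ab.
Qed.

End bounded_random_variable.

(** * A calculus of finite expectations *)

Section expectation_calculus.
Context d (S : measurableType d) (R : realType) (mu : probability S R).
Implicit Types (f g : S -> R) (a b v w : R).

(** Carrying integrability along with the value lets an inequality between expectations be reduced
    to a pointwise inequality between real linear combinations. *)
Definition has_expectation f v : Prop :=
  mu.-integrable setT (EFin \o f) /\ (\int[mu]_s f s = v)%R.

Lemma has_expectationE f v : has_expectation f v -> 'E_mu[f] = v%:E.
Proof. by move=> [intf <-]; exact: expectation_Rintegral. Qed.

Lemma has_expectation_bounded f M : measurable_fun setT f ->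
  (forall s, (`|f s| <= M)%R) -> has_expectation f (\int[mu]_s f s)%R.
Proof. by move=> mf fM; split => //; exact: bounded_integrable fM. Qed.

Lemma has_expectation_cst a : has_expectation (fun=> a) a.
Proof.
split; first exact: finite_measure_integrable_cst.
by rewrite Rintegral_cst//= probability_setT/= mulr1.
Qed.

Lemma has_expectation_indic B : measurable B ->
  has_expectation (\1_B) (fine (mu B)).
Proof.
by move=> mB; split; [exact: integrable_indic|exact: Rintegral_indic].
Qed.

Lemma has_expectationZ a f v : has_expectation f v ->
  has_expectation (fun s => a * f s)%R (a * v)%R.
Proof.
move=> [intf <-]; split; last by rewrite RintegralZl.
exact: (integrableZl measurableT a intf).
Qed.

Lemma has_expectationD f g v w : has_expectation f v -> has_expectation g w ->
  has_expectation (fun s => f s + g s)%R (v + w)%R.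
Proof.
move=> [intf <-] [intg <-]; split; last by rewrite RintegralD.
exact: (integrableD measurableT intf intg).
Qed.

Lemma le_has_expectation f g v w : has_expectation f v -> has_expectation g w ->
  (forall s, (f s <= g s)%R) -> (v <= w)%R.
Proof. by move=> [intf <-] [intg <-] fg; exact: le_Rintegral. Qed.

End expectation_calculus.

(** * Duality between the worst-case reward and the CVaR for a single distribution *)

Section worst_case_cvar.
Context d (S : measurableType d) (R : realType) (mu : probability S R).
Context (X : S -> R) (M : R) (c : R).
Context (mX : measurable_fun setT X) (XM : forall s, (`|X s| <= M)%R).
Context (c0 : (0 <= c)%R) (c1 : (c < 1)%R).
Implicit Types (W : S -> R) (m q t e beta : R).

Let shortfall beta := (\int[mu]_s Num.max (beta - X s) 0)%R.

Let shortfallE beta :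
  has_expectation mu (fun s => Num.max (beta - X s) 0)%R (shortfall beta).
Proof.
apply: (@has_expectation_bounded _ _ _ _ _ (`|beta| + M)%R).
  by apply: measurable_maxr => //; exact: measurable_funB.
move=> s; have := XM s; have := ler_norm beta; have := ler_norm (- beta)%R.
rewrite normrN => ? ? ?; have := normr_ge0 (X s); have := ler_norm (- X s)%R.
rewrite normrN => ? ?; rewrite ger0_norm ?le_max ?lexx ?orbT//.
by rewrite ge_max; apply/andP; split; lra.
Qed.

Lemma cvar_objectiveE beta : cvar_objective mu c X beta =
  (beta - (1 - c)^-1 * shortfall beta)%:E.
Proof.
by rewrite /cvar_objective (has_expectationE (shortfallE beta)) -EFinM -EFinB.
Qed.

(** For [m <= beta], integrate the pointwise bound W X >= m W + (beta - m) min(W, 1) - (beta - X)_+,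
    with min(W, 1) written as (W + 1 - |W - 1|) / 2 so that the total variation constraint
    applies. *)
Lemma le_expectation_likelihood_ratio W m beta :
  (forall s, (m <= X s)%R) -> likelihood_ratios mu c W ->
  (c * m)%:E + (1 - c)%:E * cvar_objective mu c X beta <= 'E_mu[(W \* X)%R].
Proof.
move=> mleX [intW phiW W0 EW].
have hW : has_expectation mu W 1%R.
  by split => //; have := expectation_Rintegral intW; rewrite EW => -[<-].
have [vWX hWX] : exists v, has_expectation mu (W \* X)%R v.
  exists (\int[mu]_s (W \* X)%R s)%R; split => //.
  apply: (@le_integrable _ _ _ mu _ measurableT _ (EFin \o (fun s => M * W s)%R)).
  - apply/measurable_EFinP; apply: measurable_funM => //.
    by apply/measurable_EFinP; exact: measurable_int intW.
  - move=> s _ /=; rewrite lee_fin normrM (mulrC M) normrM ler_wpM2l//.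
    by rewrite (le_trans (XM s))// ler_norm.
  - exact: (integrableZl measurableT M intW).
have hW1 := has_expectationD hW (has_expectation_cst mu (- 1)%R).
have [vT hT] : exists v, has_expectation mu (fun s => `|W s - 1|)%R v.
  exists (\int[mu]_s `|W s - 1|)%R; split => //.
  by have [/integrable_norm] := hW1.
have vTc : (vT <= 2 * c)%R.
  move: phiW; rewrite (eq_integral (fun s => (2^-1 * `|W s - 1|)%:E)); last first.
    by move=> s _; rewrite /phi_tv W0.
  have := has_expectationE (has_expectationZ (2^-1)%R hT).
  by rewrite unlock => ->; rewrite lee_fin; lra.
rewrite cvar_objectiveE -EFinM -EFinD (has_expectationE hWX) lee_fin.
rewrite mulrBr mulrA divff ?mul1r ?subr_eq0 ?gt_eqF//.
(* If [beta < m], the coefficient of |W - 1| has the wrong sign, but then E[W X] >= m suffices,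
   since the objective at [beta] is at most [beta]. *)
have [mb|bm] := leP m beta.
  pose a := ((beta - m) / 2)%R.
  have h := has_expectationD (has_expectationD (has_expectationZ (m + a)%R hW)
    (has_expectation_cst mu a)) (has_expectationD (has_expectationZ (- a)%R hT)
    (has_expectationZ (-1)%R (shortfallE beta))).
  have : ((m + a) * 1 + a + (- a * vT + -1 * shortfall beta) <= vWX)%R.
    apply: (le_has_expectation h hWX) => s /=.
    rewrite /a; have mX0 : (0 <= X s - m)%R by rewrite subr_ge0.
    have y0 : (0 <= Num.max (beta - X s) 0)%R by rewrite le_max lexx orbT.
    have : (0 <= Num.max (beta - X s) 0 - (beta - X s))%R.
      by rewrite subr_ge0 le_max lexx.
    move: (Num.max _ _) y0 => y y0 yX0.
    (* With y = (beta - X)_+, the gap in the bound is (W - 1)(X - m) + (y - (beta - X)) when W >= 1,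
       and (1 - W) y + W (y - (beta - X)) when W <= 1. *)
    have [W1|/ltW W1] := leP 1%R (W s).
      rewrite ger0_norm ?subr_ge0//.
      have : (0 <= (W s - 1) * (X s - m))%R by rewrite mulr_ge0// subr_ge0.
      by move=> ?; lra.
    rewrite ler0_norm ?subr_le0//.
    have : (0 <= (1 - W s) * y)%R by rewrite mulr_ge0// subr_ge0.
    have : (0 <= W s * (y - (beta - X s)))%R by rewrite mulr_ge0.
    by move=> ? ?; lra.
  move=> /(le_trans _); apply.
  have : (0 <= (beta - m) * (2 * c - vT))%R by rewrite mulr_ge0// subr_ge0.
  by rewrite /a => ?; lra.
have s0 : (0 <= shortfall beta)%R.
  by apply: Rintegral_ge0 => s _; rewrite le_max lexx orbT.
have : (m * 1 <= vWX)%R.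
  apply: (le_has_expectation (has_expectationZ m hW) hWX) => s /=.
  by rewrite mulrC ler_wpM2l.
have : (0 <= (1 - c) * (m - beta))%R by rewrite mulr_ge0// subr_ge0 ltW.
by move=> ? ?; lra.
Qed.

(** The point [q] is chosen before [e]: letting [e] tend to 0 then makes the bound exact at one
    fixed [q], which yields a maximizer and not only a supremum. *)
Lemma near_optimal_likelihood_ratio m :
  (forall e, (0 < e)%R -> 0 < mu [set s | (X s < m + e)%R]) ->
  exists q, forall e, (0 < e)%R ->
    exists2 W, likelihood_ratios mu c W &
      'E_mu[(W \* X)%R] <=
        (c * m)%:E + (1 - c)%:E * cvar_objective mu c X q + e%:E.
Proof.
move=> mu_gt0.
have [|q [t [/andP[t0 t1] qt]]] := @quantile_split _ _ _ mu X M (1 - c)%R mX XM.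
  by rewrite subr_gt0 c1 gerBl.
exists q => e e0.
pose A := [set s | (X s < m + e)%R].
pose L := [set s | (X s < q)%R].
pose Q := [set s | X s = q].
have mA : measurable A by exact: measurable_ltr_set.
have mL : measurable L by exact: measurable_ltr_set.
have mQ : measurable Q by exact: measurable_eqr_set.
pose V s : R := (\1_L s + t * \1_Q s)%R.
have hV : has_expectation mu V (1 - c)%R.
  rewrite -qt; apply: has_expectationD; first exact: has_expectation_indic.
  exact/has_expectationZ/has_expectation_indic.
pose pA := fine (mu A).
have pA0 : (0 < pA)%R.
  rewrite fine_gt0// mu_gt0//=.
  by rewrite (le_lt_trans (probability_le1 _ _))// ltry.
(* The height at which the mass [c] is spread uniformly over [A]. *)
pose k := (c / pA)%R.
have k0 : (0 <= k)%R by rewrite divr_ge0// ltW.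
have kpA : (k * pA = c)%R by rewrite divfK// gt_eqF.
pose W s : R := (V s + k * \1_A s)%R.
have hkA : has_expectation mu (fun s => k * \1_A s)%R c.
  by rewrite -kpA; exact/has_expectationZ/has_expectation_indic.
have hW : has_expectation mu W 1%R.
  by rewrite -(subrK c 1%R); exact: has_expectationD.
have V01 s : (0 <= V s <= 1)%R.
  rewrite /V !indicE; case: (boolP (s \in L)) => [|_].
    rewrite inE /L/= => Xq; rewrite memNset ?mulr0 ?addr0 ?lexx ?ler01//.
    by rewrite /Q/= => Xq'; rewrite Xq' ltxx in Xq.
  by rewrite add0r; case: (s \in Q); rewrite ?mulr1 ?mulr0 ?lexx ?ler01 ?t0.
have kA0 s : (0 <= k * \1_A s)%R by rewrite mulr_ge0.
have mW : measurable_fun setT W.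
  by apply/measurable_EFinP; apply: measurable_int hW.1.
have WM s : (`|W s| <= 1 + k)%R.
  have /andP[V0 V1] := V01 s; rewrite ger0_norm; last by rewrite addr_ge0.
  by rewrite lerD// ler_piMr// indicE; case: (_ \in _).
exists W.
  split.
  - exact: hW.1.
  - have hT : has_expectation mu (fun s => `|W s - 1|)%R
        (\int[mu]_s `|W s - 1|)%R.
      split => //.
      have [+ _] := has_expectationD hW (has_expectation_cst mu (-1)%R).
      by move=> /integrable_norm.
    rewrite (eq_integral (fun s => (2^-1 * `|W s - 1|)%:E)); last first.
      by move=> s _; rewrite /phi_tv addr_ge0//; have /andP[] := V01 s.
    have := has_expectationE (has_expectationZ (2^-1)%R hT).
    rewrite unlock => ->; rewrite lee_fin.
    (* Since V <= 1, |W - 1| is at most (1 - V) + k 1_A, whose two terms have expectation [c] each;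
       halving the sum gives [c]. *)
    have h := has_expectationD (has_expectationD (has_expectation_cst mu 1%R)
      (has_expectationZ (-1)%R hV)) hkA.
    suff : (\int[mu]_s `|W s - 1| <= 1 + -1 * (1 - c) + c)%R by lra.
    apply: (le_has_expectation hT h) => s /=.
    have /andP[V0 V1] := V01 s; have := kA0 s; rewrite /W.
    by move: (k * _)%R => y y0; rewrite ler_norml; apply/andP; split; lra.
  - by move=> s; rewrite addr_ge0//; have /andP[] := V01 s.
  - exact: has_expectationE.
have hWX : has_expectation mu (W \* X)%R (\int[mu]_s (W \* X)%R s)%R.
  apply: (@has_expectation_bounded _ _ _ _ _ ((1 + k) * M)%R).
    exact: measurable_funM.
  by move=> s /=; rewrite normrM ler_pM.
rewrite cvar_objectiveE -EFinM -!EFinD (has_expectationE hWX) lee_fin.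
rewrite mulrBr mulrA divff ?mul1r ?subr_eq0 ?gt_eqF//.
(* Pointwise, V X = q V - (q - X)_+ by the choice of V, while X < m + e on [A]. The resulting excess
   is c e, which is at most e. *)
have h := has_expectationD (has_expectationD (has_expectationZ q hV)
  (has_expectationZ (-1)%R (shortfallE q))) (has_expectationZ (m + e)%R hkA).
suff : (\int[mu]_s (W \* X)%R s <=
    q * (1 - c) + -1 * shortfall q + (m + e) * c)%R.
  have : (0 <= e * (1 - c))%R by rewrite mulr_ge0 ?subr_ge0 ?ltW.
  by move=> ? ?; lra.
apply: (le_has_expectation hWX h) => s /=.
rewrite /W mulrDl lerD//.
  rewrite /V !indicE; have [Xq|Xq|Xq] := ltgtP (X s) q.
  - rewrite mem_set// memNset; last by apply/eqP; rewrite lt_eqF.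
    by rewrite max_l /=; lra.
  - rewrite memNset; last by apply/negP; rewrite -leNgt ltW.
    rewrite memNset; last by apply/eqP; rewrite gt_eqF.
    by rewrite max_r /=; lra.
  - rewrite memNset; last by rewrite /L/= Xq ltxx.
    by rewrite mem_set// max_r Xq /=; lra.
rewrite indicE; case: (boolP (s \in A)); last by rewrite !mulr0 mul0r.
by rewrite inE /A/= mulr1 mulrC => /ltW Xme; rewrite ler_wpM2r.
Qed.

Lemma worst_case_reward_cvar m : (forall s, (m <= X s)%R) ->
  (forall e, (0 < e)%R -> 0 < mu [set s | (X s < m + e)%R]) ->
  (exists q, cvar mu c X = cvar_objective mu c X q) /\
  worst_case_reward mu c X = (c * m)%:E + (1 - c)%:E * cvar mu c X.
Proof.
move=> mleX mu_gt0.
have [q qW] := near_optimal_likelihood_ratio mu_gt0.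
have worst_le : worst_case_reward mu c X <=
    (c * m)%:E + (1 - c)%:E * cvar_objective mu c X q.
  apply/lee_addgt0Pr => e e0; have [W LRW WX] := qW e e0.
  by apply: le_trans WX; apply: ereal_inf_lbound; exists W.
have worst_ge beta : (c * m)%:E + (1 - c)%:E * cvar_objective mu c X beta <=
    worst_case_reward mu c X.
  apply: le_ereal_inf_tmp => _ [W LRW <-].
  exact: le_expectation_likelihood_ratio.
(* The lower bound at any [beta] lies below the upper bound at [q]; cancelling the common term and
   the factor 1 - c > 0 shows that [q] maximizes the objective. *)
have cvarE : cvar mu c X = cvar_objective mu c X q.
  apply/eqP; rewrite eq_le; apply/andP; split; last first.
    by apply: ereal_sup_ubound; exists q.
  apply: ge_ereal_sup => _ [beta _ <-].
  have := le_trans (worst_ge beta) worst_le.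
  rewrite !cvar_objectiveE -!EFinM -!EFinD !lee_fin lerD2l ler_pM2l//.
  by rewrite subr_gt0.
split; first by exists q.
by apply/eqP; rewrite eq_le cvarE worst_le worst_ge.
Qed.

End worst_case_cvar.

Theorem theorem1
  (R : realType)
  (n : nat) (dS : measure_display) (S : measurableType dS)
  (emb : S -> n.-tuple R) (S_borel : borel_embedding emb)
  (dA : measure_display) (A : measurableType dA)
  (A_finite : finite_set [set: A]) (A_discrete : forall B : set A, measurable B)
  (P : R.-pker (S * A) ~> S)
  (Pi : set (R.-pker S ~> A))
  (d_ : (R.-pker S ~> A) -> probability S R)
  (Pi_harris : forall pi, Pi pi -> positive_harris (induced_chain P pi))
  (Pi_aperiodic : forall pi, Pi pi -> aperiodic (induced_chain P pi) (d_ pi))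
  (d_stationary : forall pi, Pi pi -> stationary (induced_chain P pi) (d_ pi))
  (d_density : forall pi, Pi pi -> has_lebesgue_density emb (d_ pi))
  (rew : S -> R) (rew_measurable : measurable_fun [set: S] rew)
  (Rmax : R) (rew_bounded : forall s, (`|rew s| <= Rmax)%R)
  (c : R) (c_ge0 : (0 <= c)%R) (c_lt1 : (c < 1)%R)
  (rew_ess_inf : forall pi, Pi pi ->
    ess_inf (d_ pi) (EFin \o rew) = (inf (range rew))%:E) :
  (forall pi, Pi pi ->
    (exists beta0, cvar (d_ pi) c rew = cvar_objective (d_ pi) c rew beta0) /\
    worst_case_reward (d_ pi) c rew =
      (c * inf (range rew))%:E + (1 - c)%:E * cvar (d_ pi) c rew) /\
  argmax Pi (fun pi => worst_case_reward (d_ pi) c rew) =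
  argmax Pi (fun pi => cvar (d_ pi) c rew).
Proof.
have rewm s : (inf (range rew) <= rew s)%R.
  apply: ge_inf; last by exists s.
  exists (- Rmax)%R => _ [x _ <-].
  by have := rew_bounded x; rewrite ler_norml => /andP[].
have main pi : Pi pi ->
    (exists beta0, cvar (d_ pi) c rew = cvar_objective (d_ pi) c rew beta0) /\
    worst_case_reward (d_ pi) c rew =
      (c * inf (range rew))%:E + (1 - c)%:E * cvar (d_ pi) c rew.
  (* The same number is a pointwise lower bound, as the infimum, and has positive mass just above
     it, as the essential infimum. *)
  move=> Pipi; apply: (@worst_case_reward_cvar _ _ _ _ _ Rmax) => // e e0.
  by apply: (ess_inf_lt_gt0 _ (rew_ess_inf _ Pipi)) => //; rewrite ltrDl.
split => //.
(* The affine map has a finite constant and positive finite slope 1 - c, both independent of the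
   policy, so it preserves and reflects the order on extended reals. *)
have monoE pi pi' : Pi pi -> Pi pi' ->
    (worst_case_reward (d_ pi) c rew <= worst_case_reward (d_ pi') c rew) =
    (cvar (d_ pi) c rew <= cvar (d_ pi') c rew).
  move=> /main[_ ->] /main[_ ->].
  by rewrite leeD2lE// lee_pmul2l// lte_fin subr_gt0.
by apply/seteqP; split => pi [Pipi piP]; split => // pi' Pipi';
  have := piP _ Pipi'; rewrite monoE.
Qed.
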